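(* Let $h\in\mathbb N$ be fixed, let $G_n^h=(V,E)$ be the preferential attachment graph, and let $M=hn$. Then for every $\varepsilon>0$, with high probability as $n\to\infty$, $$\forall S\subseteq V:\quad \left|\mathrm{vol}(S)-2\sqrt M\,\mu(\tilde S)\right|\le(1+\varepsilon)\,g_{\mathcal V}(h)\,\frac{M}{\sqrt h},$$ where $g_{\mathcal V}(h)=\frac16\sqrt{2\ln2\,(9\ln h+8\ln2)}+\frac23\ln2+2$.
   Context: $\mathbb N=\{1,2,\dots\}$, $[n]=\{1,\dots,n\}$. With high probability (as $n\to\infty$) means with probability tending to $1$ as $n\to\infty$, with $h$ and $\varepsilon$ fixed. Graphs are finite, undirected, and may have loops and multiple edges; $\deg(v)$ is the number of edges containing $v$, with loops counted twice; for a set $S$ of vertices, $\mathrm{vol}(S)=\sum_{v\in S}\deg(v)$ (here in $G_n^h$). Preferential attachment graph $G_n^h$: Phase 1. $T_1$ is the graph with the single (mini-)vertex $1$ and a single loop at it (so its degree is $2$). For $t\ge1$, given $T_t$, the graph $T_{t+1}$ is obtained by adding the mini-vertex $t+1$ and one edge joining it to a random mini-vertex $i$, where, conditionally on the history, $\Pr(i=s)=\frac{\deg_{T_t}(s)}{2t+1}$ for $1\le s\le t$ and $\Pr(i=t+1)=\frac1{2t+1}$ (a loop). Continue until $T_{hn}$, with vertex set $\tilde V=[hn]$, is obtained. Phase 2. $G_n^h$ is obtained from $T_{hn}$ by merging, for each $i\in[n]$, the mini-vertices $h(i-1)+1,\dots,h(i-1)+h$ into a single vertex $i$, keeping loops and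 multiple edges. So $V=[n]$ and $|E|=hn=M$. For $S\subseteq V$, $\tilde S\subseteq[M]$ is the set of corresponding mini-vertices, $\tilde S=\bigcup_{i\in S}\{h(i-1)+1,\dots,hi\}$. For $A\subseteq[M]$ define $\mu(A)=\frac{\sqrt\pi}{2}\sum_{j\in A}c_{j-1}$, where $c_0=1$ and $c_j=\prod_{i=1}^j\frac{2i-1}{2i}$ for $j\ge1$. *)

(* Defs.v *)
From HB Require Import structures.
From mathcomp Require Import all_boot all_order all_algebra.
From mathcomp Require Import all_classical all_reals all_analysis.
Set Implicit Arguments.
Unset Strict Implicit.
Unset Printing Implicit Defensive.
Import Order.TTheory GRing.Theory Num.Theory.
Import numFieldNormedType.Exports.
Local Open Scope ring_scope.

(* A multigraph on V is its list of edges; (u, v) and (v, u) stand for the same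
   undirected edge, (v, v) is a loop, repetitions are multiple edges. *)
Definition mgraph (V : finType) := seq (V * V).

Definition deg (V : finType) (G : mgraph V) (v : V) : nat :=
  (\sum_(e <- G) ((e.1 == v) + (e.2 == v)))%N.

Definition vol (V : finType) (G : mgraph V) (S : {set V}) : nat :=
  (\sum_(v in S) deg G v)%N.

Definition map_graph (U V : finType) (f : U -> V) (G : mgraph U) : mgraph V :=
  [seq (f e.1, f e.2) | e <- G].

(* All labels are shifted down by one: the mini-vertices of T_t are the elements
   0, ..., t-1 of 'I_t and the vertices of G_n^h are the elements of 'I_n.

   An outcome of the first t steps records, for each step k <= t, the
   mini-vertex that the k-th mini-vertex chooses among the first k ones (itself
   included).  The process starts at the empty graph T_0; the only possible
   first step is a loop, with probability 1 / (2 * 0 + 1) = 1, which gives T_1. *)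
Fixpoint attachments (t : nat) : finType :=
  if t is t'.+1 then (attachments t' * 'I_t'.+1)%type else unit.

Fixpoint pa_tree (t : nat) : attachments t -> mgraph 'I_t :=
  match t with
  | 0 => fun _ => [::]
  | t'.+1 => fun w =>
      (ord_max, w.2) :: map_graph (widen_ord (leqnSn t')) (pa_tree w.1)
  end.

(* Conditional probability, given T_t = T, that the new mini-vertex ord_max is
   joined to s; the case None is s = ord_max. *)
Definition attach_prob (R : realType) (t : nat) (T : mgraph 'I_t)
    (s : 'I_t.+1) : R :=
  (if unlift ord_max s is Some s' then (deg T s')%:R else 1) / (2 * t + 1)%:R.

Fixpoint pa_weight (R : realType) (t : nat) : attachments t -> R :=
  match t with
  | 0 => fun _ => 1
  | t'.+1 => fun w => pa_weight R w.1 * attach_prob R (pa_tree w.1) w.2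
  end.

Definition pa_Pr (R : realType) (t : nat) (A : pred (attachments t)) : R :=
  \sum_(w | A w) pa_weight R w.

Lemma merge_subproof (h n : nat) (j : 'I_(h * n)) : (j %/ h < n)%N.
Proof.
case: j => j /= hj; case: h hj => [|h] hj; first by rewrite mul0n in hj.
by rewrite ltn_divLR // mulnC.
Qed.

Definition merge_mini (h n : nat) (j : 'I_(h * n)) : 'I_n :=
  Ordinal (merge_subproof j).

Definition pa_graph (h n : nat) (w : attachments (h * n)) : mgraph 'I_n :=
  map_graph (@merge_mini h n) (pa_tree w).

Definition mini (h n : nat) (S : {set 'I_n}) : {set 'I_(h * n)} :=
  [set j | merge_mini j \in S].

Definition c (R : realType) (j : nat) : R :=
  \prod_(1 <= i < j.+1) ((2 * i%:R - 1) / (2 * i%:R)).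

(* With labels starting at 0, the term c_{j-1} of mini-vertex j becomes c_j. *)
Definition mu (R : realType) (M : nat) (A : {set 'I_M}) : R :=
  Num.sqrt pi / 2 * \sum_(j in A) c R j.

Definition gV (R : realType) (h : nat) : R :=
  6^-1 * Num.sqrt (2 * ln 2 * (9 * ln h%:R + 8 * ln 2)) + 2 / 3 * ln 2 + 2.

(* pa_weight is a probability mass function. *)
Lemma pa_weight_ge0 (R : realType) (t : nat) (w : attachments t) :
  0 <= pa_weight R w.
Proof.
elim: t w => [|t IH] /= w; first exact: ler01.
apply: mulr_ge0 => //; apply: divr_ge0 => //.
by case: unlift => // s; rewrite ?ler01.
Qed.

Lemma sum_deg (V : finType) (G : mgraph V) :
  (\sum_v deg G v = 2 * size G)%N.
Proof.
have one (x : V) : (\sum_v (x == v) = 1)%N.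
  by rewrite (bigD1 x) //= eqxx big1 // => v /negPf; rewrite eq_sym => ->.
rewrite exchange_big /= -sum1_size big_distrr /=.
by apply: eq_bigr => e _; rewrite big_split /= !one.
Qed.

Lemma size_pa_tree (t : nat) (w : attachments t) : size (pa_tree w) = t.
Proof. by elim: t w => //= t IH w; rewrite size_map IH. Qed.

Lemma sum_attach_prob (R : realType) (t : nat) (w : attachments t) :
  \sum_s attach_prob R (pa_tree w) s = 1.
Proof.
rewrite -mulr_suml (bigD1 ord_max) //= unlift_none.
rewrite (reindex_omap (lift ord_max) (unlift ord_max)); last first.
  by move=> s; case: unliftP => [j ->|->] //=; rewrite eqxx.
under eq_bigl do rewrite liftK eqxx eq_sym neq_lift.
under eq_bigr do rewrite liftK.
rewrite -natr_sum sum_deg size_pa_tree.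
by rewrite [1 + _]addrC natr1 addn1 divff ?pnatr_eq0.
Qed.

Lemma sum_pa_weight (R : realType) (t : nat) :
  \sum_(w : attachments t) pa_weight R w = 1.
Proof.
elim: t => [|t IH] /=; first by rewrite (bigD1 tt) //= big1 ?addr0 //; case.
rewrite -(pair_bigA _ (fun w s => pa_weight R w * attach_prob R (pa_tree w) s)).
rewrite /= -[RHS]IH; apply: eq_bigr => w _.
by rewrite -mulr_sumr sum_attach_prob mulr1.
Qed.

(* Main.v *)
(* For a set A of mini-vertices let D_t be its volume in T_t and let m_t be the
   sum of the c_j over j in A, j < t.  Then Y_t = c_t D_t - m_t is a martingale,
   whose increment at step t + 1 is c_{t+1} times a centred Bernoulli variable.
   Deterministically |Y_n| <= 2 n c_n, and from step n on Hoeffding's inequality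
   bounds the moment generating function by
   exp (x^2 / 8 * sum_{n < i <= hn} c_i^2) <= exp (x^2 ln h / (8 pi)), because
   2 / (2 i + 1) <= pi c_i^2 <= 1 / i (Wallis).  Hence each A violates the bound
   with probability at most a constant times rho^n with rho < 1/2, which survives
   the union over the 2^n sets S.  The constant obtained,
   sqrt (ln 2 ln h / 2) + 2/3 ln 2 + 2, is at most gV h; in it, 2 comes from the
   first n mini-vertices and the rest from the martingale. *)
Require Import Defs.
From mathcomp Require Import all_boot all_order all_algebra.
From mathcomp Require Import all_classical all_reals all_analysis.
From mathcomp Require Import ring lra.
Set Implicit Arguments.
Unset Strict Implicit.
Unset Printing Implicit Defensive.
Import Order.TTheory GRing.Theory Num.Theory.
Import numFieldNormedType.Exports.
Local Open Scope classical_set_scope.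
Local Open Scope ring_scope.

(** * Hoeffding's lemma for a Bernoulli variable *)

Lemma is_derive_ge0_le (R : realType) (f df : R -> R) (a b : R) :
  a <= b -> (forall x, a <= x <= b -> is_derive x 1 f (df x)) ->
  (forall x, a <= x <= b -> 0 <= df x) -> f a <= f b.
Proof.
move=> leab fdf df_ge0.
have [||x xab fab] := @MVT_segment R f df a b leab.
- by move=> x /[!in_itv]/= /andP[ax xb]; apply: fdf; rewrite !ltW.
- apply: derivable_within_continuous => x /[!in_itv]/= xab.
  by have [] := fdf _ xab.
by rewrite -subr_ge0 fab mulr_ge0 ?subr_ge0 ?df_ge0.
Qed.

(** The difference [g] of the logarithms of the two sides satisfies [g 0 = 0] and [dg 0 = 0] and is
    convex, so it is nonnegative on both sides of 0. *)
Lemma bernoulli_mgf_le (R : realType) (p x : R) : 0 <= p <= 1 ->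
  1 - p + p * expR x <= expR (x * p + x ^+ 2 / 8).
Proof.
move=> /andP[p0 p1].
pose u (y : R) := 1 - p + p * expR y.
have u_gt0 y : 0 < u y.
  rewrite /u; have := expR_gt0 y; have [->|pn0] := eqVneq p 0; first by lra.
  have : 0 < p by rewrite lt0r pn0.
  move=> pp ee; have := mulr_gt0 pp ee; lra.
have du y : is_derive y (1 : R) u (p * expR y).
  by apply: is_derive_eq; rewrite /GRing.scale/=; ring.
pose g (y : R) := y * p + y ^+ 2 / 8 - ln (u y).
pose dg (y : R) := p + y / 4 - p * expR y / u y.
pose ddg (y : R) := 4^-1 - p * expR y * (1 - p) / u y ^+ 2.
have g_dg y : is_derive y (1 : R) g (dg y).
  have dln : is_derive y (1 : R) (@ln R \o u) (p * expR y / u y).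
    by rewrite mulrC; apply: is_derive1_comp; exact: is_derive1_ln.
  have -> : g = p \*: id + 8^-1 \*: (id ^+ 2) - (@ln R \o u).
    by apply/funext => z; rewrite /g mulrC [X in _ + X - _]mulrC.
  apply: is_derive_eq; rewrite /GRing.scale/= /dg ?expr1 ?mulr1; lra.
have dg_ddg y : is_derive y (1 : R) dg (ddg y).
  have dV : is_derive y (1 : R) (fun z => (u z)^-1) (- (p * expR y) / u y ^+ 2).
    apply: is_derive_eq; first by apply: is_deriveV; rewrite gt_eqF.
    by rewrite /GRing.scale/=; ring.
  have -> : dg = cst p + 4^-1 \*: id - (p \*: expR) * (fun z => (u z)^-1).
    by apply/funext => z; rewrite /dg [X in _ + X - _]mulrC.
  apply: is_derive_eq; have := u_gt0 y; rewrite /GRing.scale/= /ddg /u => uy.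
  rewrite (_ : p *: expR y = p * expR y) //; field; exact: lt0r_neq0.
have ddg_ge0 y : 0 <= ddg y.
  rewrite /ddg subr_ge0 ler_pdivrMr ?exprn_gt0 //.
  (* With a = 1 - p and b = p e^y this is 4 a b <= (a + b)^2, the source of the constant 1/8. *)
  rewrite /u; have := sqr_ge0 (1 - p - p * expR y); lra.
have dg0 : dg 0 = 0 by rewrite /dg /u expR0; field; apply/eqP; lra.
have g0 : g 0 = 0.
  by rewrite /g /u expR0 mul0r expr0n /= mulr1 subrK ln1; ring.
suff : 0 <= g x.
  rewrite /g subr_ge0 -ler_expR lnK // posrE; exact: u_gt0.
have [x_ge0|/ltW x_le0] := leP 0 x.
- rewrite -g0; apply: (is_derive_ge0_le (f := g) (df := dg)) => // y /andP[y0 _].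
  by rewrite -dg0; apply: (is_derive_ge0_le (f := dg) (df := ddg)).
- suff : (- g) x <= (- g) 0 by rewrite /= lerN2 g0.
  apply: (is_derive_ge0_le (f := - g) (df := - dg)) => // y /andP[_ y0].
  by rewrite oppr_ge0 -dg0; apply: (is_derive_ge0_le (f := dg) (df := ddg)).
Qed.

(** * Wallis' integrals and the size of c_j *)

(* The antiderivative of cos ^+ n vanishing at 0, by the usual reduction formula:
   it gives Wallis' integrals without integration. *)
Fixpoint cos_pow_prim (R : realType) (n : nat) : R -> R :=
  match n with
  | 0 => id
  | 1 => sin
  | (m.+1 as p).+1 => fun x =>
      (cos x ^+ p * sin x + p%:R * cos_pow_prim m x) / p.+1%:R
  end.
Arguments cos_pow_prim : clear implicits.

Lemma is_derive_cos_pow_prim (R : realType) n (x : R) :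
  is_derive x 1 (cos_pow_prim R n) (cos x ^+ n).
Proof.
elim/ltn_ind: n => -[|[|m]] IH /=.
- by rewrite expr0; exact: is_derive_id.
- by rewrite expr1; exact: is_derive_sin.
have {IH} IH := IH m (ltnW (ltnSn _)).
pose k : R := m.+2%:R^-1.
have -> : (fun y => (cos y ^+ m.+1 * sin y + m.+1%:R * cos_pow_prim R m y) / m.+2%:R)
  = k \*: ((cos ^+ m.+1) * sin + m.+1%:R \*: cos_pow_prim R m).
  apply/funext => y; rewrite [LHS]mulrC; congr (_ * (_ + _)).
  by rewrite mulrfctE exprfctE.
apply: is_derive_eq.
have s2 : sin x * sin x = 1 - cos x * cos x.
  by rewrite -!expr2 -(cos2Dsin2 x); ring.
rewrite /GRing.scale/= exprfctE !exprS mulrN mulrA.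
rewrite mulrN [sin x * _]mulrCA [sin x * _]mulrC mulrAC -mulrA.
rewrite /k s2 -[m.+2%:R]natr1; field.
by apply: lt0r_neq0; have := ler0n R m; lra.
Qed.

Lemma cos_pow_prim0 (R : realType) n : cos_pow_prim R n 0 = 0.
Proof.
elim/ltn_ind: n => -[|[|m]] IH //=; first exact: sin0.
by rewrite sin0 IH ?(ltnW (ltnSn _)) // !mulr0 addr0 mul0r.
Qed.

Definition wallis (R : realType) n : R := cos_pow_prim R n (pi / 2).

Lemma wallisSS (R : realType) n :
  wallis R n.+2 = n.+1%:R / n.+2%:R * wallis R n.
Proof. by rewrite /wallis /= cos_pihalf expr0n mul0r add0r mulrAC. Qed.

(** On [0, pi/2] the cosine lies in [0, 1], so the difference of the two antiderivatives increases
    from its value 0 at 0. *)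
Lemma wallis_nincr (R : realType) n : wallis R n.+1 <= wallis R n.
Proof.
pose f := cos_pow_prim R n - cos_pow_prim R n.+1.
suff : f 0 <= f (pi / 2).
  have fE y : f y = cos_pow_prim R n y - cos_pow_prim R n.+1 y by [].
  by rewrite !fE !cos_pow_prim0 subrr subr_ge0.
apply: (is_derive_ge0_le (f := f) (df := fun x => cos x ^+ n - cos x ^+ n.+1)).
- by rewrite divr_ge0 // pi_ge0.
- by move=> x _; apply: is_deriveB; exact: is_derive_cos_pow_prim.
move=> x /andP[x0 x1]; have cos_x0 : 0 <= cos x.
  by apply: cos_ge0_pihalf; rewrite x1 (le_trans _ x0) // oppr_le0 divr_ge0 // pi_ge0.
by rewrite subr_ge0 exprS ler_piMl ?exprn_ge0 // cos_le1.
Qed.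

Lemma c_0 (R : realType) : c R 0 = 1.
Proof. by rewrite /c big_nil. Qed.

Lemma c_succ (R : realType) j : c R j.+1 = c R j * ((2 * j + 1)%:R / (2 * j + 2)%:R).
Proof.
rewrite /c big_nat_recr //=; congr (_ * (_ / _)).
  by rewrite natrD natrM -natr1; ring.
by rewrite natrD natrM -natr1; ring.
Qed.

Lemma c_gt0 (R : realType) j : 0 < c R j.
Proof.
elim: j => [|j IH]; first by rewrite c_0.
by rewrite c_succ mulr_gt0 // divr_gt0 // ltr0n ?addn1 ?addn2.
Qed.

Lemma double_succ_c (R : realType) j :
  (2 * j.+1)%:R * c R j.+1 = (2 * j + 1)%:R * c R j.
Proof.
rewrite c_succ mulnS [(2 + _)%N]addnC [LHS]mulrCA [X in _ * X = _]mulrC divfK.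
  exact: mulrC.
by rewrite pnatr_eq0 addn2.
Qed.

Lemma wallis_even (R : realType) n : wallis R (2 * n) = c R n * (pi / 2).
Proof.
elim: n => [|n IH]; first by rewrite c_0 mul1r.
by rewrite mulnS add2n wallisSS IH c_succ addn2 addn1; ring.
Qed.

Lemma wallis_odd (R : realType) n :
  wallis R (2 * n).+1 = ((2 * n + 1)%:R * c R n)^-1.
Proof.
elim: n => [|n IH]; first by rewrite c_0 mulr1 /wallis /= sin_pihalf invr1.
rewrite mulnS add2n wallisSS IH c_succ addn2 addn1.
have := c_gt0 R n; set d := c R n => d0.
have : (2 * n)%:R >= 0 :> R by [].
set m : R := (2 * n)%:R.
rewrite -[(2 * n).+3%:R]natr1 -[(2 * n).+2%:R]natr1 -[(2 * n).+1%:R]natr1 -/m => m0.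
field; rewrite !gt_eqF //; lra.
Qed.

(** For n > 0 this is W_{2n} <= W_{2n-1}, where the recursion turns (2n-1) c_{n-1} into 2n c_n. *)
Lemma c_sqr_le (R : realType) n : pi * n%:R * c R n ^+ 2 <= 1.
Proof.
case: n => [|n]; first by rewrite mulr0 mul0r.
have := wallis_nincr R (2 * n).+1.
rewrite -[(2 * n).+2]/(2 + 2 * n)%N -mulnS wallis_even wallis_odd.
rewrite -double_succ_c; have d0 := c_gt0 R n.+1.
rewrite -[X in _ <= X -> _]div1r ler_pdivlMr ?mulr_gt0 ?ltr0n //.
rewrite natrM; lra.
Qed.

(** This is W_{2n+1} <= W_{2n}. *)
Lemma c_sqr_ge (R : realType) n : 2 <= pi * (2 * n + 1)%:R * c R n ^+ 2.
Proof.
have := wallis_nincr R (2 * n).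
rewrite wallis_even wallis_odd -[X in X <= _ -> _]div1r ler_pdivrMr; first by lra.
by rewrite mulr_gt0 ?c_gt0 // addn1.
Qed.

(** * Volumes of sets of mini-vertices *)

Lemma volE (V : finType) (G : mgraph V) (S : {set V}) :
  vol G S = (\sum_(e <- G) ((e.1 \in S) + (e.2 \in S)))%N.
Proof.
have one x : (\sum_(v in S) (x == v) = (x \in S))%N.
  have [xS|xS] := boolP (x \in S).
    rewrite (bigD1 x) //= eqxx big1 // => v /andP[_ /negPf].
    by rewrite eq_sym => ->.
  by rewrite big1 // => v vS; case: eqP xS => // ->; rewrite vS.
rewrite /vol /deg exchange_big /=.
by apply: eq_bigr => e _; rewrite big_split /= !one.
Qed.

Definition mini_vol (a : pred nat) (t : nat) (w : attachments t) : nat :=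
  vol (pa_tree w) [set j | a (val j)].

Lemma mini_volS (a : pred nat) t (w : attachments t.+1) :
  mini_vol a w = (a t + a w.2 + mini_vol a w.1)%N.
Proof.
rewrite /mini_vol !volE /= big_cons big_map !inE /=.
by congr addn; apply: eq_bigr => e _; rewrite !inE.
Qed.

Lemma mini_vol_le (a : pred nat) t (w : attachments t) :
  (mini_vol a w <= 2 * t)%N.
Proof.
elim: t w => [|t IH] w; first by rewrite /mini_vol volE big_nil.
by rewrite mini_volS mulnS leq_add // (@leq_add _ _ 1 1) ?leq_b1.
Qed.

(* Sets of mini-vertices are predicates on nat, so that the same one can be used
   in all the trees T_t; this one encodes [mini h S]. *)
Definition in_merged (h n : nat) (S : {set 'I_n}) (j : nat) : bool :=
  [exists i in S, val i == (j %/ h)%N].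

Lemma in_mergedE h n (S : {set 'I_n}) (j : 'I_(h * n)) :
  in_merged h S j = (merge_mini j \in S).
Proof.
apply/existsP/idP => [[i /andP[iS /eqP ij]]|jS].
  by rewrite (_ : merge_mini j = i) //; apply: val_inj.
by exists (merge_mini j); rewrite jS /=.
Qed.

Lemma vol_pa_graph h n (w : attachments (h * n)) (S : {set 'I_n}) :
  vol (pa_graph w) S = mini_vol (in_merged h S) w.
Proof.
rewrite /mini_vol !volE big_map.
by apply: eq_bigr => e _; rewrite !inE !in_mergedE.
Qed.

(** * The martingale of one set *)

Definition c_mass (R : realType) (a : pred nat) (t : nat) : R :=
  \sum_(j < t) (a j)%:R * c R j.

Lemma mu_mini (R : realType) h n (S : {set 'I_n}) :
  mu R (mini h S) = Num.sqrt pi / 2 * c_mass R (in_merged h S) (h * n).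
Proof.
rewrite /mu; congr (_ * _); rewrite /c_mass big_mkcond; apply: eq_bigr => j _.
by rewrite in_mergedE inE; case: ifP; rewrite ?mul1r ?mul0r.
Qed.

(** Since 2(j+1) c_{j+1} - 2j c_j = c_j, the sum of all c_j with j < t telescopes to 2t c_t. *)
Lemma c_mass_bounds (R : realType) a t : 0 <= c_mass R a t <= (2 * t)%:R * c R t.
Proof.
apply/andP; split.
  by apply: sumr_ge0 => j _; rewrite mulr_ge0 // ltW // c_gt0.
elim: t => [|t IH]; first by rewrite /c_mass big_ord0 mul0r.
rewrite /c_mass big_ord_recr /= -/(c_mass R a t) double_succ_c.
rewrite natrD mulrDl lerD // mul1r.
by case: (a t); rewrite ?mul1r ?mul0r // ltW // c_gt0.
Qed.

(** The martingale Y_t of the set [a]. *)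
Definition dev (R : realType) (a : pred nat) t (w : attachments t) : R :=
  c R t * (mini_vol a w)%:R - c_mass R a t.

(** Both terms of [dev] lie in [0, 2t c_t]. *)
Lemma dev_abs_le (R : realType) a t (w : attachments t) :
  `|dev R a w| <= (2 * t)%:R * c R t.
Proof.
have /andP[m0 m1] := c_mass_bounds R a t.
have d0 := c_gt0 R t.
have v0 : 0 <= c R t * (mini_vol a w)%:R by rewrite mulr_ge0 // ltW.
have v1 : c R t * (mini_vol a w)%:R <= (2 * t)%:R * c R t.
  by rewrite mulrC ler_pM2r // ler_nat mini_vol_le.
by rewrite ler_norml /dev; lra.
Qed.

Lemma attach_prob_mean (R : realType) (a : pred nat) t (w : attachments t) :
  \sum_s attach_prob R (pa_tree w) s * (a s)%:R
  = (mini_vol a w + a t)%:R / (2 * t + 1)%:R.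
Proof.
rewrite (bigD1 ord_max) //= {1}/attach_prob unlift_none.
rewrite (reindex_omap (lift ord_max) (unlift ord_max)); last first.
  by move=> s; case: unliftP => [j ->|->] //=; rewrite eqxx.
under eq_bigl do rewrite liftK eqxx eq_sym neq_lift.
under eq_bigr do rewrite /attach_prob liftK lift_max mulrAC.
rewrite -mulr_suml mulrAC mul1r -mulrDl; congr (_ * _); rewrite natrD [RHS]addrC.
congr (_ + _).
rewrite /mini_vol /vol natr_sum big_mkcond [RHS]big_mkcond /=.
by apply: eq_bigr => s _; rewrite inE; case: (a s); rewrite ?mulr1 ?mulr0.
Qed.

(** Given T_t, the mean of D_{t+1} is (D_t + a_t)(2t+2)/(2t+1), where a_t is 1 or 0 as t is in the
    set or not. Multiplied by c_{t+1} it becomes c_t (D_t + a_t), and the new term c_t a_t of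
    [c_mass] removes the drift. *)
Lemma devS (R : realType) (a : pred nat) t (w : attachments t.+1) :
  dev R a w = dev R a w.1 + c R t.+1 *
    ((a w.2)%:R - \sum_s attach_prob R (pa_tree w.1) s * (a s)%:R).
Proof.
rewrite attach_prob_mean /dev mini_volS /c_mass big_ord_recr /= c_succ.
rewrite (natrD _ (2 * t) 1) (natrD _ (2 * t) 2) (natrD _ (a t + a w.2)).
rewrite !(natrD _ _ (nat_of_bool _)).
have m0 : 0 <= (2 * t)%:R :> R by [].
set m : R := (2 * t)%:R in m0 *.
field; apply/andP; split; apply: lt0r_neq0; lra.
Qed.

(** * Exponential moments and the tail bound for one set *)

Lemma indicator_mgf_le (R : realType) (I : finType) (q : I -> R) (f : pred I)
    (x : R) :
  (forall i, 0 <= q i) -> \sum_i q i = 1 ->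
  \sum_i q i * expR (x * ((f i)%:R - \sum_j q j * (f j)%:R))
  <= expR (x ^+ 2 / 8).
Proof.
move=> q_ge0 q1; set p := \sum_j q j * (f j)%:R.
have p01 : 0 <= p <= 1.
  rewrite sumr_ge0; last by move=> i _; rewrite mulr_ge0.
  by rewrite -q1 ler_sum // => i _; rewrite ler_piMr //; case: (f i).
have -> : \sum_i q i * expR (x * ((f i)%:R - p))
    = (1 - p + p * expR x) * expR (- (x * p)).
  have -> : 1 - p + p * expR x = \sum_i q i * expR (x * (f i)%:R).
    (* For b in {0, 1}, e^(x b) = 1 + b (e^x - 1). *)
    transitivity (\sum_i (q i + q i * (f i)%:R * (expR x - 1))).
      by rewrite big_split /= -mulr_suml q1 -/p; ring.
    by apply: eq_bigr => i _; case: (f i); rewrite ?mulr1 ?mulr0 ?expR0; ring.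
  rewrite mulr_suml; apply: eq_bigr => i _.
  by rewrite -mulrA -expRD mulrBr.
rewrite expRN ler_pdivrMr ?expR_gt0 // -expRD [_ + x * p]addrC.
exact: bernoulli_mgf_le.
Qed.

Lemma attach_prob_ge0 (R : realType) t (T : mgraph 'I_t) s :
  0 <= attach_prob R T s.
Proof. by rewrite /attach_prob divr_ge0 //; case: unlift. Qed.

(* The part up to t0 is bounded by [dev_abs_le], the rest by Hoeffding. *)
Lemma dev_mgf_le (R : realType) (a : pred nat) (x : R) t0 t : (t0 <= t)%N ->
  \sum_(w : attachments t) pa_weight R w * expR (x * dev R a w)
  <= expR (`|x| * ((2 * t0)%:R * c R t0)
           + x ^+ 2 / 8 * \sum_(t0 <= i < t) c R i.+1 ^+ 2).
Proof.
have base : \sum_(w : attachments t0) pa_weight R w * expR (x * dev R a w)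
    <= expR (`|x| * ((2 * t0)%:R * c R t0)).
  set B := expR _.
  rewrite -[B]mul1r -[X in X * B](sum_pa_weight R t0) mulr_suml; apply: ler_sum => w _.
  rewrite ler_wpM2l ?pa_weight_ge0 // ler_expR (le_trans (ler_norm _)) // normrM.
  by rewrite ler_wpM2l // dev_abs_le.
elim: t => [|t IH]; rewrite leq_eqVlt => /predU1P[E|//].
  by subst t0; rewrite big_geq // mulr0 addr0.
  by subst t0; rewrite big_geq // mulr0 addr0.
rewrite ltnS => t0t; rewrite big_nat_recr //= mulrDr addrA expRD.
rewrite -(pair_bigA _ (fun w s => pa_weight R w * attach_prob R (pa_tree w) s *
  expR (x * dev R a ((w, s) : attachments t.+1)))) /=.
(* With the first t steps [w] fixed, the sum over the last choice is a moment generating function at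
   x c_{t+1} of a centred indicator. *)
apply: (@le_trans _ _ (\sum_(w : attachments t)
  pa_weight R w * expR (x * dev R a w) * expR (x ^+ 2 / 8 * c R t.+1 ^+ 2))).
  apply: ler_sum => w _.
  under eq_bigr do rewrite devS /= mulrDr mulrA expRD mulrACA -mulrA.
  rewrite -!mulr_sumr mulrA ler_wpM2l ?mulr_ge0 ?pa_weight_ge0 ?expR_ge0 //.
  rewrite mulrAC -exprMn.
  apply: indicator_mgf_le (sum_attach_prob R w) => s.
  exact: attach_prob_ge0.
by rewrite -mulr_suml ler_wpM2r ?expR_ge0 // IH.
Qed.

(** This is ln (1 + y) <= y at y = -1/(i+1). *)
Lemma inv_natS_le_ln (R : realType) i : (0 < i)%N ->
  i.+1%:R^-1 <= ln i.+1%:R - ln i%:R :> R.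
Proof.
move=> i0.
have j0 : 0 < i.+1%:R :> R by rewrite ltr0n.
have k0 : 0 < i%:R :> R by rewrite ltr0n.
rewrite -lerN2 opprB -ln_div ?posrE //.
have -> : i%:R / i.+1%:R = 1 + - i.+1%:R^-1 :> R.
  by rewrite -natr1 in j0 *; field; exact: lt0r_neq0.
apply: le_ln1Dx; rewrite ltrN2 invf_lt1 // ltr1n ltnS //.
Qed.

(** Each term is at most 1/(pi (i+1)), and the logarithmic bound telescopes. *)
Lemma sum_c_sqr_le (R : realType) t0 t : (0 < t0 <= t)%N ->
  \sum_(t0 <= i < t) c R i.+1 ^+ 2 <= (ln t%:R - ln t0%:R) / pi.
Proof.
move=> /andP[t0_gt0].
elim: t => [|t IH]; rewrite leq_eqVlt => /predU1P[E|//].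
  by subst t0; rewrite big_geq // subrr mul0r.
  by subst t0; rewrite big_geq // subrr mul0r.
rewrite ltnS => t0t; rewrite big_nat_recr //=.
have -> : (ln t.+1%:R - ln t0%:R) / pi
    = (ln t%:R - ln t0%:R) / pi + (ln t.+1%:R - ln t%:R) / pi :> R by ring.
apply: lerD; first exact: IH.
rewrite ler_pdivlMr ?pi_gt0 //.
apply: le_trans (inv_natS_le_ln _ (leq_trans t0_gt0 t0t)).
rewrite -[leRHS]div1r ler_pdivlMr ?ltr0n //.
by have := c_sqr_le R t.+1; lra.
Qed.

(** Chernoff's bound with parameters x and -x, added for the two tails. The deterministic part of
    the threshold cancels the contribution of the first t0 steps, so only [lam] remains. *)
Lemma dev_tail_le (R : realType) (a : pred nat) (x lam : R) t0 t :
  (0 < t0 <= t)%N -> 0 <= x ->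
  pa_Pr R (fun w : attachments t => (2 * t0)%:R * c R t0 + lam < `|dev R a w|)
  <= 2 * expR (x ^+ 2 / 8 * ((ln t%:R - ln t0%:R) / pi) - x * lam).
Proof.
move=> t0t x0; set B := _ * c R t0.
have mgf y : `|y| = x -> \sum_(w : attachments t)
    pa_weight R w * expR (y * dev R a w) * expR (- (x * (B + lam)))
    <= expR (x ^+ 2 / 8 * ((ln t%:R - ln t0%:R) / pi) - x * lam).
  move=> yx; rewrite -mulr_suml.
  have /andP[t0_gt0 let0t] := t0t.
  have := dev_mgf_le a y let0t.
  rewrite -(ler_pM2r (expR_gt0 (- (x * (B + lam))))) => /le_trans; apply.
  rewrite -expRD ler_expR yx -/B -(real_normK (num_real y)) yx.
  have := ler_wpM2l (_ : 0 <= x ^+ 2 / 8) (sum_c_sqr_le R t0t).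
  rewrite divr_ge0 ?sqr_ge0 // => /(_ isT).
  by lra.
have xx : `|x| = x by rewrite ger0_norm.
have xN : `|- x| = x by rewrite normrN.
rewrite mulr_natl mulr2n; apply: le_trans (lerD (mgf x xx) (mgf (- x) xN)).
rewrite -big_split /pa_Pr big_mkcond /=; apply: ler_sum => w _.
have w0 := pa_weight_ge0 R w.
case: ifP => [dw|_]; last by rewrite addr_ge0 // !mulr_ge0 ?expR_ge0.
rewrite -!mulrA -mulrDr -[leLHS]mulr1 ler_wpM2l // -!expRD.
have [d0|d0] := leP 0 (dev R a w).
  rewrite (ger0_norm d0) in dw.
  rewrite -[leLHS]addr0 lerD ?expR_ge0 // -expR0 ler_expR.
  by rewrite -mulrBr mulr_ge0 //; lra.
rewrite (ltr0_norm d0) in dw.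
rewrite -[leLHS]add0r lerD ?expR_ge0 // -expR0 ler_expR.
by rewrite mulNr -mulrN -mulrBr mulr_ge0 //; lra.
Qed.

(** * From the martingale back to the volume *)

(** Wallis' inequalities put s^2 = pi n c_n^2 between 1 - 1/(2n+1) and 1; the lower bound passes to
    s because s^2 <= s for s in [0, 1]. *)
Lemma sqrt_pi_c_bounds (R : realType) n :
  1 - (2 * n + 1)%:R^-1 <= Num.sqrt (pi * n%:R) * c R n <= 1.
Proof.
set s := _ * c R n.
have s0 : 0 <= s by rewrite mulr_ge0 ?sqrtr_ge0 // ltW // c_gt0.
have s2 : s ^+ 2 = pi * n%:R * c R n ^+ 2.
  by rewrite exprMn sqr_sqrtr // mulr_ge0 // pi_ge0.
have s_le1 : s <= 1.
  by rewrite -(@expr_le1 _ 2) // s2 c_sqr_le.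
rewrite s_le1 andbT; apply: (@le_trans _ _ (s ^+ 2)); last first.
  by rewrite expr2 ler_piMr.
rewrite s2; have H := c_sqr_ge R n.
have m0 : 0 < (2 * n + 1)%:R :> R by rewrite addn1.
rewrite -(ler_pM2r m0) mulrBl mulVf ?gt_eqF //.
move: H; rewrite natrD natrM.
have := ler0n R n; set d := c R n ^+ 2; nra.
Qed.

(* The summand [2 / 3 * ln 2] is only needed to be positive: it makes the failure
   probability of a single set strictly smaller than [2^-n]. *)
Definition gV_main (R : realType) (h : nat) : R :=
  Num.sqrt (ln 2 * ln h%:R / 2) + 2 / 3 * ln 2.

(** After multiplication by 6 and squaring, the two square roots become 18 ln 2 ln h and 18 ln 2 ln
    h + 16 (ln 2)^2. *)
Lemma gV_ge (R : realType) h : (0 < h)%N -> gV_main R h + 2 <= gV R h.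
Proof.
move=> h0; rewrite /gV_main /gV lerD2r lerD2r.
have l2 : 0 <= ln 2 :> R by rewrite ln_ge0 // ler1n.
have lh : 0 <= ln h%:R :> R by rewrite ln_ge0 // ler1n.
have p1 := mulr_ge0 l2 lh; have p2 := mulr_ge0 l2 l2.
set A := Num.sqrt _; set B := Num.sqrt _.
suff : 6 * A <= B by lra.
rewrite -(ler_pXn2r (n := 2)) ?nnegrE ?mulr_ge0 ?sqrtr_ge0 //.
rewrite exprMn !sqr_sqrtr; lra.
Qed.

Lemma gV_main_gt0 (R : realType) h : 0 < gV_main R h.
Proof.
rewrite /gV_main ltr_wpDl ?sqrtr_ge0 // !mulr_gt0 //.
by rewrite ln_gt0 // ltr1n.
Qed.

Lemma sqrt_pi_natM (R : realType) h n : Num.sqrt (pi * (h * n)%:R)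
  = Num.sqrt (pi * n%:R) * Num.sqrt h%:R :> R.
Proof. by rewrite natrM -sqrtrM ?mulr_ge0 ?pi_ge0 // mulrAC mulrA. Qed.

(** The subtracted term is sqrt(pi M) times [c_mass], and sqrt(pi M) is close to 1/c_M, so
    multiplying by c_M gives [dev] up to a small error. That error and the rounding of 2n c_n / c_M
    to 2 n sqrt h cost 1 each, hence the final 2. *)
Lemma vol_deviation_le (R : realType) h n (K : R)
    (w : attachments (h * n)) (S : {set 'I_n}) :
  (0 < h)%N -> (0 < n)%N ->
  `|dev R (in_merged h S) w|
    <= (2 * n)%:R * c R n + K * (n%:R * Num.sqrt h%:R) * c R (h * n) ->
  `|(vol (pa_graph w) S)%:R - 2 * Num.sqrt (h * n)%:R * mu R (mini h S)|
    <= (K + 2) * (n%:R * Num.sqrt h%:R) + 2.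
Proof.
move=> h_gt0 n_gt0; rewrite mu_mini vol_pa_graph; set a := in_merged h S => Hdev.
have sqrt_piM := sqrt_pi_natM R h n.
have M_gt0 : (0 < h * n)%N by rewrite muln_gt0 h_gt0.
set M := (h * n)%N in w Hdev sqrt_piM M_gt0 *.
have cM := c_gt0 R M; have cn := c_gt0 R n.
have /andP[m0 m1] := c_mass_bounds R a M.
have /andP[sM0 sM1] := sqrt_pi_c_bounds R M.
have /andP[sn0 sn1] := sqrt_pi_c_bounds R n.
have -> : 2 * Num.sqrt M%:R * (Num.sqrt pi / 2 * c_mass R a M)
    = Num.sqrt (pi * M%:R) * c_mass R a M.
  by rewrite sqrtrM ?pi_ge0 //; field.
rewrite /dev in Hdev.
set v : R := (mini_vol a w)%:R in Hdev *.
set m := c_mass R a M in m0 m1 Hdev *.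
set sM := Num.sqrt (pi * M%:R) in sqrt_piM sM0 sM1 *.
set sn := Num.sqrt (pi * n%:R) in sqrt_piM sn0 sn1 *.
set N : R := n%:R * Num.sqrt h%:R in Hdev *.
rewrite -(ler_pM2r cM) -{1}(gtr0_norm cM) -normrM.
have -> : (v - sM * m) * c R M = (c R M * v - m) + m * (1 - sM * c R M) by ring.
apply: (le_trans (ler_normD _ _)).
(* The bound 2M c_M on m meets the factor 1/(2M+1). *)
have e1 : `|m * (1 - sM * c R M)| <= c R M.
  have d0 : 0 <= 1 - sM * c R M by rewrite subr_ge0.
  have d1 : 1 - sM * c R M <= (2 * M + 1)%:R^-1 by lra.
  rewrite ger0_norm ?mulr_ge0 //; apply: le_trans (ler_pM m0 d0 m1 d1) _.
  rewrite mulrAC ler_piMl ?(ltW cM) // ler_pdivrMr ?addn1 ?ltr0n //.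
  by rewrite mul1r ler_nat.
(* Here c_n <= 1/sqrt(pi n), while c_M is almost 1/sqrt(pi h n); the extra 1 absorbs the loss, as
   sqrt h >= 1. *)
have e2 : (2 * n)%:R * c R n <= (2 * N + 1) * c R M.
  have sn_gt0 : 0 < sn by rewrite sqrtr_gt0 mulr_gt0 ?pi_gt0 ?ltr0n.
  have n0 : 0 < n%:R :> R by rewrite ltr0n.
  rewrite -(ler_pM2r sn_gt0); apply: (@le_trans _ _ (2 * n%:R)).
    by rewrite natrM; nra.
  move: sM0; rewrite sqrt_piM /N.
  have qh := sqr_sqrtr (ler0n R h).
  have q1 : 1 <= Num.sqrt h%:R :> R by rewrite -[leLHS]sqrtr1 ler_wsqrtr // ler1n.
  set q := Num.sqrt h%:R in qh q1 *.
  have M0 : 0 < (2 * M + 1)%:R :> R by rewrite addn1.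
  rewrite -(ler_pM2r M0) mulrBl mulVf ?gt_eqF // natrD natrM /M natrM -qh.
  have z0 : 0 < sn * c R M by rewrite mulr_gt0.
  have q0 : 0 < q by apply: lt_le_trans q1.
  move=> H.
  have {H} : q * (2 * (q * n%:R))
      <= q * ((sn * c R M) * (2 * (q ^+ 2 * n%:R) + 1)) by lra.
  rewrite ler_pM2l // => H; rewrite -(ler_pM2l q0).
  apply: (le_trans (y := sn * c R M * (2 * (q ^+ 2 * n%:R) + 1))); first by lra.
  have := ler_wpM2r (ltW z0) q1; lra.
have := lerD Hdev e1.
by lra.
Qed.

(** * Union bound over all sets of vertices *)

(** Since [x * lam] is about 2 n ln 2, half of it pays for the 2^n sets. The other half has to beat
    the variance term n (ln 2)^2 ln h / (2 K^2). The chosen [x] is asymptotically the Chernoff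
    optimum at the critical value K^2 = ln 2 ln h / 2. *)
Lemma dev_union_le (R : realType) h n (K := gV_main R h) (M := (h * n)%N) :
  (0 < h)%N -> (0 < n)%N ->
  pa_Pr R (fun w : attachments M => [exists S : {set 'I_n},
     (2 * n)%:R * c R n + K * (n%:R * Num.sqrt h%:R) * c R M
     < `|dev R (in_merged h S) w|])
  <= 4 * expR (- (ln 2 - (ln 2) ^+ 2 * ln h%:R / (2 * K ^+ 2))) ^+ n.
Proof.
move=> h_gt0 n_gt0; set lam := K * _ * _.
(* This [x] is not optimal, but unlike [4 K / ln h * _] it makes sense at h = 1. *)
set x := 2 * ln 2 / K * Num.sqrt (pi * n%:R) : R.
have x0 : 0 <= x.
  by rewrite !mulr_ge0 ?sqrtr_ge0 ?invr_ge0 ?ln_ge0 ?ler1n // ltW // gV_main_gt0.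
have nM : (0 < n <= M)%N by rewrite n_gt0 leq_pmull.
apply: (@le_trans _ _ (\sum_(S : {set 'I_n}) pa_Pr R (fun w : attachments M =>
     (2 * n)%:R * c R n + lam < `|dev R (in_merged h S) w|))).
  rewrite /pa_Pr; under [leRHS]eq_bigr do rewrite big_mkcond.
  rewrite exchange_big big_mkcond /=; apply: ler_sum => w _.
  have nonneg (b : bool) : 0 <= (if b then pa_weight R w else 0).
    by case: b => //; exact: pa_weight_ge0.
  case: ifP => [/existsP[S PS]|_]; last by rewrite sumr_ge0.
  by rewrite (bigD1 S) //= PS lerDl sumr_ge0.
apply: le_trans (ler_sum _ (fun S _ => dev_tail_le (in_merged h S) lam nM x0)) _.
rewrite sumr_const -cardsT -powersetT card_powerset cardsT card_ord.
have pow2 : (2 ^ n)%:R = expR (n%:R * ln 2) :> R.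
  by rewrite natrX expRM_natl lnK // posrE.
rewrite -[_ *+ 2 ^ n]mulr_natr pow2 -expRM_natl -[leLHS]mulrA -expRD.
(* One factor 2 comes from the two tails; the other, e^(ln 2), pays for replacing sqrt(pi M) c_M by
   1 in [x * lam]. *)
have -> : 4 = 2 * expR (ln 2) :> R by rewrite lnK ?posrE //; lra.
rewrite -[leRHS]mulrA -expRD ler_pM2l // ler_expR.
have K0 := gV_main_gt0 R h; rewrite -/K in K0.
have pi0 := pi_gt0 R.
have -> : ln M%:R - ln n%:R = ln h%:R :> R.
  by rewrite natrM lnM ?posrE ?ltr0n // addrK.
have -> : x ^+ 2 / 8 * (ln h%:R / pi) = n%:R * (ln 2 ^+ 2 * ln h%:R / (2 * K ^+ 2)).
  rewrite /x exprMn sqr_sqrtr ?mulr_ge0 ?(ltW pi0) //.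
  by move: pi0; move: (@pi R) => P P0; field; rewrite !gt_eqF.
have -> : x * lam = 2 * ln 2 * (n%:R * (Num.sqrt (pi * M%:R) * c R M)).
  by rewrite sqrt_pi_natM /x /lam; field; rewrite gt_eqF.
suff : n%:R - 2^-1 <= n%:R * (Num.sqrt (pi * M%:R) * c R M) :> R.
  have l2 : 0 < ln 2 :> R by rewrite ln_gt0 // ltr1n.
  move=> /(ler_wpM2l (ltW l2)); lra.
have /andP[+ _] := sqrt_pi_c_bounds R M.
move=> /(ler_wpM2l (ler0n R n)); apply: le_trans.
rewrite mulrBr mulr1 lerD2l lerN2 ler_pdivrMr ?addn1 ?ltr0n //.
rewrite ler_pdivlMl // -natrM ler_nat ltnW // ltnS leq_pmul2l //.
by rewrite leq_pmull.
Qed.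

(** * Passage to the limit *)

Lemma pa_Pr_le1 (R : realType) t (A : pred (attachments t)) : pa_Pr R A <= 1.
Proof.
rewrite -(sum_pa_weight R t) /pa_Pr big_mkcond; apply: ler_sum => w _.
by case: (A w) => //; exact: pa_weight_ge0.
Qed.

Lemma pa_Pr_ge (R : realType) t (A E : pred (attachments t)) :
  (forall w, ~~ E w -> A w) -> 1 - pa_Pr R E <= pa_Pr R A.
Proof.
move=> EA; rewrite lerBlDr -(sum_pa_weight R t) /pa_Pr.
rewrite [X in _ <= X + _]big_mkcond [X in _ <= _ + X]big_mkcond -big_split /=.
apply: ler_sum => w _; have := pa_weight_ge0 R w; have := EA w.
by case: (E w) => [_|->//]; case: (A w) => ?; lra.
Qed.

(** The claim amounts to 2 K^2 > ln 2 ln h. The square root in [gV_main] alone would give equality,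
    and the positive second summand makes it strict. *)
Lemma gV_main_rate_gt0 (R : realType) h : (0 < h)%N ->
  0 < ln 2 - ln 2 ^+ 2 * ln h%:R / (2 * gV_main R h ^+ 2) :> R.
Proof.
move=> h0; have K0 := gV_main_gt0 R h.
have l2 : 0 < ln 2 :> R by rewrite ln_gt0 // ltr1n.
have lh : 0 <= ln h%:R :> R by rewrite ln_ge0 // ler1n.
have a2 : Num.sqrt (ln 2 * ln h%:R / 2) ^+ 2 = ln 2 * ln h%:R / 2 :> R.
  by rewrite sqr_sqrtr // divr_ge0 // mulr_ge0 // ltW.
rewrite subr_gt0 ltr_pdivrMr ?mulr_gt0 ?exprn_gt0 // expr2 -mulrA ltr_pM2l //.
rewrite /gV_main; have := sqrtr_ge0 (ln 2 * ln h%:R / 2 : R).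
set s := Num.sqrt _ in a2 * => s0.
have := mulr_ge0 s0 (ltW l2); have := mulr_gt0 l2 l2; nra.
Qed.

Theorem theorem8 (R : realType) (h : nat) (h_gt0 : (0 < h)%N)
    (eps : R) (eps_gt0 : 0 < eps) :
  (fun n : nat =>
     pa_Pr R (fun w : attachments (h * n) =>
       [forall S : {set 'I_n},
          `| (vol (pa_graph w) S)%:R
             - 2 * Num.sqrt (h * n)%:R * mu R (mini h S) |
          <= (1 + eps) * gV R h * ((h * n)%:R / Num.sqrt h%:R)]))
    @ \oo --> (1 : R).
Proof.
set r := expR (- (ln 2 - ln 2 ^+ 2 * ln h%:R / (2 * gV_main R h ^+ 2))) : R.
apply: (@squeeze_cvgr _ _ _ _ (fun n => 1 - 4 * r ^+ n) (cst 1)); last 2 first.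
- rewrite -[X in _ --> X]subr0 -[X in _ - X](mulr0 4).
  apply: cvgB; first exact: cvg_cst.
  apply: cvgMr; apply: cvg_expr.
  by rewrite ger0_norm ?expR_ge0 // expR_lt1 oppr_lt0 gV_main_rate_gt0.
- exact: cvg_cst.
near=> n.
rewrite pa_Pr_le1 andbT.
have n_gt0 : (0 < n)%N by near: n; exact: nbhs_infty_gt.
(* As [gV] is at least 2, this makes eps times [gV] times n sqrt h at least 2, which absorbs the
   additive error 2. *)
have n_large : eps^-1 <= n%:R by near: n; exact: nbhs_infty_ger.
apply: le_trans (_ : 1 - pa_Pr R (fun w : attachments (h * n) =>
  [exists S : {set 'I_n}, (2 * n)%:R * c R n
     + gV_main R h * (n%:R * Num.sqrt h%:R) * c R (h * n)
     < `|dev R (in_merged h S) w|]) <= _).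
  by rewrite lerD2l lerN2; exact: dev_union_le.
apply: pa_Pr_ge.
move=> w /existsPn devS; apply/forallP => S; have := devS S; rewrite -leNgt.
move=> /(vol_deviation_le h_gt0 n_gt0)/le_trans; apply.
have h0 : 0 < h%:R :> R by rewrite ltr0n.
have q1 : 1 <= Num.sqrt h%:R :> R by rewrite -[leLHS]sqrtr1 ler_wsqrtr // ler1n.
have -> : (h * n)%:R / Num.sqrt h%:R = n%:R * Num.sqrt h%:R :> R.
  rewrite natrM -[X in X * _ / _](sqr_sqrtr (ltW h0)); field.
  by rewrite gt_eqF // sqrtr_gt0.
have N1 : 1 <= eps * (n%:R * Num.sqrt h%:R).
  have : 1 <= eps * n%:R by rewrite -ler_pdivrMl // mulr1.
  by move=> H; rewrite mulrA -[leLHS]mulr1 ler_pM.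
have := gV_ge R h_gt0; have := gV_main_gt0 R h.
have : 0 <= n%:R * Num.sqrt h%:R :> R by rewrite mulr_ge0 // sqrtr_ge0.
move: N1; set N := n%:R * _; set K := gV_main R h; set g := gV R h => N1 N0 K0 gK.
have := ler_wpM2r N0 gK; have := ler_wpM2l (_ : 0 <= g - 2) N1.
rewrite subr_ge0 (le_trans _ gK) ?lerDr ?(ltW K0) // => /(_ isT).
lra.
Unshelve. all: by end_near.
Qed.
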